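(* Let $$R(D_e)=\min_{0\preceq K_X\preceq\Sigma_X}\left\{\frac12\log\frac{\det\Sigma_X}{\det K_X}:\ \mathrm{tr}(\tilde WK_X)\le D_e'\right\}.$$ Let $A_X=\Sigma_X^{1/2}\tilde W\Sigma_X^{1/2}=U\Lambda U^\top$ with $U$ orthogonal and $\Lambda=\mathrm{diag}(\lambda_1,\dots,\lambda_k)$, and define $\mathcal I_+=\{i:\lambda_i>0\}$ and $\mathcal I_0=\{i:\lambda_i\le0\}$. Then there exists an optimizer of this problem of the form $$K_X^\star=\Sigma_X^{1/2}U\,\mathrm{diag}(d_1^\star,\dots,d_k^\star)\,U^\top\Sigma_X^{1/2},$$ with $0<d_i^\star\le1$, $d_i^\star=1$ for $i\in\mathcal I_0$, and, for $i\in\mathcal I_+$, $$d_i^\star=\min\left\{1,\ \frac{\nu^\star}{\lambda_i}\right\}.$$ If $D_e'\ge\mathrm{tr}(A_X)$, then $K_X^\star=\Sigma_X$ is feasible and $R(D_e)=0$. If $D_e'<\mathrm{tr}(A_X)$, then the semantic constraint $\mathrm{tr}(\tilde WK_X)\le D_e'$ is active and $\nu^\star>0$ is uniquely determined by $$\sum_{i\in\mathcal I_+}\min\{\lambda_i,\nu^\star\}=D_e'-\sum_{i\in\mathcal I_0}\lambda_i.$$ Moreover, the solution is in the interior (no saturation $d_i^\star=1$ on any $i\in\mathcal I_+$) if and only if $\nu^\star<\min_{i\in\mathcal I_+}\lambda_i$. In that interior regime, $$\nu^\star=\frac{D_e'-\sum_{i\in\mathcal I_0}\lambda_i}{|\mathcal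 I_+|},$$ and the resulting rate is $$R(D_e)=\frac12\sum_{i\in\mathcal I_+}\log\left(\frac{\lambda_i}{\nu^\star}\right).$$
   Context: $B\in\mathbb R^{k\times k}$; $\Sigma_X\succ0$ and $W_e\succ0$ are symmetric $k\times k$ matrices; $\Sigma_V$ is a $k\times k$ covariance matrix. $\tilde W=W_e(B-I)+(B-I)^\top W_e+W_e$ (symmetric, not necessarily positive semidefinite). $D_e'=D_e-\mathrm{tr}(W_eC_0)$ with $C_0=(B-I)\Sigma_X(B-I)^\top+\Sigma_V$, where $D_e$ is a distortion level. $\preceq$ is the Loewner order; $\Sigma_X^{1/2}$ is the symmetric positive definite square root; logarithms are natural. (The function $R(D_e)$ is the strategic rate--distortion function of an encoder that observes $X\sim\mathcal N(0,\Sigma_X)$ and measures quadratic loss with weight $W_e$ between $\Theta=BX+V$, $V\sim\mathcal N(0,\Sigma_V)$ independent of $X$, and the decoder's MMSE estimate of $X$.)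
   Formalization: The formal theorem assumes R(D_e) is finite (some feasible K_X is nonsingular); otherwise no optimizer with all d_i>0 exists (e.g. k=1, B=W_e=Σ_X=1, Σ_V=0, D_e=0). The formula for ν* dividing by |I_+| is stated for nonempty I_+. *)

(* Defs.v *)
From HB Require Import structures.
From mathcomp Require Import all_boot all_order all_algebra.
From mathcomp Require Import all_classical all_reals all_analysis.

Set Implicit Arguments.
Unset Strict Implicit.
Unset Printing Implicit Defensive.

Import Order.TTheory GRing.Theory Num.Theory.

Local Open Scope ring_scope.

Section LoewnerOrder.
Context {R : realType} {k : nat}.
Implicit Types A B S : 'M[R]_k.

Definition psdmx A : Prop :=
  A \is symmetricmx /\ forall x : 'cV[R]_k, 0 <= \tr (x^T *m A *m x).

Definition pdmx A : Prop :=
  A \is symmetricmx /\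
  forall x : 'cV[R]_k, x != 0 -> 0 < \tr (x^T *m A *m x).

Definition loewner_le A B : Prop := psdmx (B - A).

(* The two conditions determine S: every positive definite matrix has exactly
   one positive definite square root. *)
Definition is_pd_sqrtmx A S : Prop := pdmx S /\ S *m S = A.

Definition orthogonalmx A : Prop := A^T *m A = 1%:M.

End LoewnerOrder.

Section RateDistortion.
Context {R : realType} {k : nat}.
Implicit Types (B We SX SV K : 'M[R]_k) (De : R).

(* With Theta = B X + V and K the error covariance of the MMSE estimate Xh of X,
   E[(Theta - Xh)^T We (Theta - Xh)]
     = \tr (We *m offset_cov B SX SV) + \tr (weight_tilde B We *m K). *)
Definition weight_tilde B We : 'M[R]_k :=
  We *m (B - 1%:M) + (B - 1%:M)^T *m We + We.

Definition offset_cov B SX SV : 'M[R]_k :=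
  (B - 1%:M) *m SX *m (B - 1%:M)^T + SV.

Definition distortion_budget B We SX SV De : R :=
  De - \tr (We *m offset_cov B SX SV).

Definition feasible B We SX SV De K : Prop :=
  [/\ loewner_le 0 K, loewner_le K SX &
      \tr (weight_tilde B We *m K) <= distortion_budget B We SX SV De].

(* The order constraint allows a singular K, where log (det SX / det K) is
   +oo; [ln] would give 0 there. *)
Definition rate_objective SX K : \bar R :=
  if 0 < \det K then (2^-1 * ln (\det SX / \det K))%:E else +oo%E.

(* Written as an infimum, +oo when no feasible K is nonsingular; it is attained at
   K exactly when [optimizer] holds. *)
Definition rate_distortion B We SX SV De : \bar R :=
  ereal_inf [set rate_objective SX K | K in feasible B We SX SV De]%classic.

Definition optimizer B We SX SV De K : Prop :=
  feasible B We SX SV De K /\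
  forall K', feasible B We SX SV De K' ->
    (rate_objective SX K <= rate_objective SX K')%E.

End RateDistortion.

Definition pos_indices {R : realType} {k : nat} (lam : 'rV[R]_k) : {set 'I_k} :=
  [set i | 0 < lam 0 i]%SET.

Definition nonpos_indices {R : realType} {k : nat} (lam : 'rV[R]_k) :
    {set 'I_k} :=
  [set i | lam 0 i <= 0]%SET.

(* Main.v *)
Require Import Defs.
From HB Require Import structures.
From mathcomp Require Import all_boot all_order all_algebra.
From mathcomp Require Import all_classical all_reals all_analysis.
From mathcomp Require Import ring lra.

(* Put T = S U, so that T T^T = SX and T^T Wt T = diag lam. Writing K = T M T^T
   turns the problem into maximising ln (det M) over 0 <= M <= 1 subject to
   \sum_i lam_i M_ii <= D', which only involves the diagonal of M apart from the
   determinant. By Hadamard's inequality det M <= \prod_i M_ii, so a diagonal M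
   is optimal, and there the tangent bound ln x <= ln d + (x - d) / d at the
   water-filling point certifies optimality with Lagrange multiplier 1 / nu.
   The same chain of inequalities forces the constraint to be active at every
   optimizer. Finiteness of the rate supplies a nonsingular feasible M, which
   makes the amount of water D' - \sum_(i in I0) lam_i positive. *)

Set Implicit Arguments.
Unset Strict Implicit.

Import Order.TTheory GRing.Theory Num.Theory.
Import numFieldNormedType.Exports.

Local Open Scope ring_scope.

(** * Positive semidefinite matrices and Hadamard's inequality *)

Lemma symmetricmxP (R : realType) n (A : 'M[R]_n) :
  reflect (A^T = A) (A \is symmetricmx).
Proof.
rewrite is_hermitianmxE expr0 scale1r eq_sym.
have -> : map_mx idfun A^T = A^T by apply/matrixP => i j; rewrite !mxE.
exact: eqP.
Qed.

Lemma psdmx_congr (R : realType) m n (P : 'M[R]_(m, n)) (A : 'M[R]_n) :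
  psdmx A -> psdmx (P *m A *m P^T).
Proof.
move=> [/symmetricmxP sA pA]; split.
  by apply/symmetricmxP; rewrite !trmx_mul trmxK sA mulmxA.
by move=> x; have := pA (P^T *m x); rewrite trmx_mul trmxK !mulmxA.
Qed.

Lemma psdmx_congr_unit (R : realType) n (P A : 'M[R]_n) :
  P \in unitmx -> psdmx (P *m A *m P^T) <-> psdmx A.
Proof.
move=> uP; split; last exact: psdmx_congr.
move=> /(psdmx_congr (invmx P)).
rewrite !mulmxA mulVmx // mul1mx -mulmxA trmx_inv mulmxV ?mulmx1 //.
by rewrite unitmx_tr.
Qed.

Lemma psdmx_diag (R : realType) n (d : 'rV[R]_n) :
  (forall i, 0 <= d 0 i) -> psdmx (diag_mx d).
Proof.
move=> d0; split; first by apply/symmetricmxP; rewrite tr_diag_mx.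
move=> x; rewrite trace_mx11 mxE sumr_ge0 // => i _.
by rewrite mul_mx_diag !mxE mulrAC mulr_ge0 // -expr2 sqr_ge0.
Qed.

Lemma psdmx_diag_ge0 (R : realType) n (A : 'M[R]_n) i : psdmx A -> 0 <= A i i.
Proof.
move=> [_ /(_ (delta_mx i 0))].
by rewrite trace_mx11 trmx_delta -rowE -colE !mxE.
Qed.

(** Along the line of vectors [t e_i + e_j] the quadratic form is affine in [t] with slope
    [2 * A i j], so it stays nonnegative only if the slope vanishes. *)
Lemma psdmx_diag_eq0 (R : realType) n (A : 'M[R]_n) i j :
  psdmx A -> A i i = 0 -> A i j = 0.
Proof.
move=> [/symmetricmxP sA pA] Aii0; apply/eqP/negPn/negP => Aij.
have Aji : A j i = A i j by rewrite -[in LHS]sA mxE.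
(* This [t] makes the value [2 * t * A i j + A j j] equal to -1. *)
pose t := - (A j j + 1) / (2 * A i j).
have := pA (t *: delta_mx i 0 + delta_mx j 0).
have -> : (t *: delta_mx i 0 + delta_mx j 0)^T =
          t *: delta_mx 0 i + delta_mx 0 j :> 'rV_n.
  by apply/matrixP => p q; rewrite !mxE andbC [in X in _ + X]andbC.
rewrite trace_mx11 !mulmxDl !mulmxDr.
rewrite -!scalemxAl -!scalemxAr -!rowE -!colE !mxE Aii0 Aji.
suff -> : t * (t * 0) + t * A i j + (t * A i j + A j j) = -1 by rewrite ler0N1.
by rewrite /t; field.
Qed.

(* Gaussian elimination of the first row and column: the Schur complement is
   again positive semidefinite, and its diagonal only decreases. *)
Lemma det_psdmx_bounds (R : realType) n (A : 'M[R]_n) :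
  psdmx A -> 0 <= \det A <= \prod_i A i i.
Proof.
elim: n A => [|n IHn] A pA; first by rewrite det_mx00 big_ord0 ler01 lexx.
have A0 i : 0 <= A i i by exact: psdmx_diag_ge0.
(* A zero pivot forces the whole first row to vanish, and with it the determinant. *)
have [a0|a_neq0] := eqVneq (A 0 0) 0.
  rewrite (expand_det_row A 0) big1 ?lexx ?prodr_ge0 // => j _.
  by rewrite (psdmx_diag_eq0 _ pA a0) mul0r.
have a_gt0 : 0 < A 0 0 by rewrite lt_def a_neq0 A0.
pose a := A 0 0; pose A' : 'M[R]_(1 + n) := A.
pose b := dlsubmx A'; pose D := drsubmx A'.
have sA : A^T = A by case: pA => /symmetricmxP.
have aE : ulsubmx A' = a%:M.
  apply/matrixP => i j; rewrite !ord1 !mxE mulr1n.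
  by congr (A _ _); exact/val_inj.
have bE : ursubmx A' = b^T by rewrite /b trmx_dlsub (sA : A'^T = A').
have AE : A' = block_mx a%:M b^T b D by rewrite -[LHS]submxK aE bE.
pose C := D - a^-1 *: (b *m b^T).
have pC : psdmx C.
  (* Congruence by the block row [(- a^-1 b, 1)] cancels the first block column and leaves exactly
     the Schur complement. *)
  have := psdmx_congr (row_mx (- a^-1 *: b) 1%:M) pA.
  rewrite -/A' AE mul_row_block !mul1mx tr_row_mx mul_row_col.
  rewrite trmx1 mulmx1 mul_mx_scalar scalerA mulrN mulfV // scaleN1r addNr.
  by rewrite mul0mx add0r -scalemxAl scaleNr addrC.
have detA : \det A = a * \det C.
  transitivity (\det (block_mx 1%:M 0 (a^-1 *: b) 1%:M *m
                      block_mx a%:M b^T 0 C)).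
    congr (\det _); rewrite mulmx_block !mul1mx !mul0mx !addr0.
    rewrite -[LHS]/A' AE mul_mx_scalar scalerA mulfV // scale1r /C.
    by rewrite -scalemxAl addrC subrK.
  by rewrite det_mulmx det_lblock det_ublock !det1 !mul1r det_scalar1.
have /andP[C0 CP] := IHn _ pC.
rewrite detA mulr_ge0 ?(ltW a_gt0) //= big_ord_recl ler_wpM2l ?(ltW a_gt0) //.
apply: le_trans CP _; apply: ler_prod => i _.
rewrite psdmx_diag_ge0 //= !mxE rshift1 lerBlDr lerDl.
rewrite mulr_ge0 ?invr_ge0 ?(ltW a_gt0) //.
by rewrite big_ord_recl big_ord0 addr0 !mxE -expr2 sqr_ge0.
Qed.

Lemma pdmx_unitmx (R : realType) n (A : 'M[R]_n) : pdmx A -> A \in unitmx.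
Proof.
move=> [_ pA]; rewrite unitmxE unitfE; apply/det0P => -[v v0 vA].
have vT0 : v^T != 0 by rewrite -trmx0 (inj_eq trmx_inj).
by have := pA _ vT0; rewrite trmxK vA mul0mx linear0 ltxx.
Qed.

(** * Logarithms and the scalar water-filling profile *)

Lemma ln_prod (R : realType) (I : finType) (F : I -> R) :
  (forall i, 0 < F i) -> ln (\prod_i F i) = \sum_i ln (F i).
Proof.
move=> F0.
(* Positivity is carried through the induction, since [lnM] asks for positive factors. *)
suff [_ //] : 0 < \prod_i F i /\ ln (\prod_i F i) = \sum_i ln (F i).
apply: (big_ind2 (fun x y => 0 < x /\ ln x = y)) => //.
  by rewrite ln1.
by move=> x _ y _ [x0 <-] [y0 <-]; rewrite mulr_gt0 // lnM.
Qed.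

Lemma ln_le_tangent (R : realType) (x y : R) :
  0 < x -> 0 < y -> ln x <= ln y + (x / y - 1).
Proof.
move=> x0 y0; have xy0 : 0 < x / y by rewrite divr_gt0.
have -> : ln x = ln y + ln (x / y).
  by rewrite ln_div ?posrE //; ring.
have := @le_ln1Dx R (x / y - 1); rewrite lerD2l.
rewrite [1 + _]addrC subrK; apply; lra.
Qed.

(** For [l <= 0] the value 1 is the best in (0, 1]: a smaller [x] lowers [ln x] and cannot lower the
    cost [l * x]. *)
Definition water (R : realType) (nu l : R) : R :=
  if 0 < l then Num.min 1 (nu / l) else 1.

Section Water.
Variable R : realType.
Implicit Types nu l x : R.

Lemma water_le1 nu l : water nu l <= 1.
Proof. by rewrite /water; case: ifP => // _; rewrite ge_min lexx. Qed.

(** The hypothesis is conditional because the level chosen under a slack budget is 0 when no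
    eigenvalue is positive. *)
Lemma water_gt0 nu l : (0 < l -> 0 < nu) -> 0 < water nu l.
Proof.
rewrite /water; case: ifP => [l0 /(_ isT) nu0|_ _]; last exact: ltr01.
by rewrite lt_min ltr01 divr_gt0.
Qed.

Lemma water_eq1 nu l : (0 < l -> l <= nu) -> water nu l = 1.
Proof.
rewrite /water; case: ifP => // l0 /(_ isT) lnu.
by apply/min_idPl; rewrite ler_pdivlMr // mul1r.
Qed.

Lemma water_neq1 nu l : 0 < l -> (water nu l != 1) = (nu < l).
Proof.
move=> l0; rewrite /water l0.
have -> : (nu < l) = (nu / l < 1) by rewrite ltr_pdivrMr // mul1r.
by case: leP => [le1|lt1]; rewrite ?eqxx ?lt_eqF // ltNge le1.
Qed.

Lemma mulr_water nu l :
  l * water nu l = if 0 < l then Num.min l nu else l.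
Proof.
rewrite /water; case: ifP => l0; rewrite ?mulr1 // minr_pMr ?(ltW l0) //.
by rewrite mulr1 mulrCA mulfV ?mulr1 // gt_eqF.
Qed.

(* Below saturation the tangent of [ln] at the water level has slope [l / nu];
   at saturation the slope is 1 >= [l / nu], and [x <= 1] absorbs the gap. *)
Lemma ln_le_water nu l x : 0 < nu -> 0 < x <= 1 ->
  ln x <= ln (water nu l) + nu^-1 * (l * x - l * water nu l).
Proof.
move=> nu0 /andP[x0 x1].
have [lnu|nul] := leP l nu.
  rewrite water_eq1 // ln1 add0r mulr1.
  have := ln_le_tangent x0 (@ltr01 R); rewrite ln1 add0r divr1.
  move=> /le_trans; apply.
  have -> : nu^-1 * (l * x - l) = (l / nu) * (x - 1) by field; lra.
  rewrite -[leLHS]mul1r ler_wnM2r ?subr_le0 //.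
  by rewrite ler_pdivrMr // mul1r.
have l0 := lt_trans nu0 nul.
have wE : water nu l = nu / l.
  by rewrite /water l0; apply/min_idPr; rewrite ler_pdivrMr // mul1r ltW.
have := ln_le_tangent x0 (_ : 0 < water nu l); rewrite wE.
move=> /(_ _)/le_trans; apply.
  by rewrite divr_gt0.
suff -> : nu^-1 * (l * x - l * (nu / l)) = x / (nu / l) - 1 by [].
by field; lra.
Qed.

End Water.

(** * Uniqueness and existence of the water level *)

Section WaterLevel.
Variables (R : realType) (I : finType) (P : pred I) (lam : I -> R).
Hypothesis lam0 : forall i, P i -> 0 < lam i.

(** An unsaturated total leaves some index with [nu < lam i]; its term rises strictly with the
    level, and no other term falls. *)
Lemma water_level_lt nu nu' :
  nu < nu' -> \sum_(i | P i) Num.min (lam i) nu < \sum_(i | P i) lam i ->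
  \sum_(i | P i) Num.min (lam i) nu < \sum_(i | P i) Num.min (lam i) nu'.
Proof.
move=> nunu' lt_sum.
have [i Pi nul] : exists2 i, P i & nu < lam i.
  apply: contrapT => no_i; move: lt_sum; rewrite (eq_bigr lam) ?ltxx // => i Pi.
  apply/min_idPl; rewrite leNgt; apply/negP => nul.
  by apply: no_i; exists i.
rewrite (bigD1 i) //= [ltRHS](bigD1 i) //= ltr_leD //.
  by rewrite lt_min !gt_min nul nunu' !orbT.
by apply: ler_sum => j _; rewrite le_min !ge_min lexx (ltW nunu') orbT.
Qed.

Lemma water_level_uniq nu nu' c : c < \sum_(i | P i) lam i ->
  \sum_(i | P i) Num.min (lam i) nu = c ->
  \sum_(i | P i) Num.min (lam i) nu' = c -> nu' = nu.
Proof.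
move=> cs nuc nu'c; case: (ltgtP nu nu') => // /water_level_lt.
  by rewrite nuc nu'c ltxx => /(_ cs).
by rewrite nuc nu'c ltxx => /(_ cs).
Qed.

(** Intermediate value theorem for the poured amount, which is 0 at level 0 and full at level
    [s]. *)
Lemma water_level_exists c : 0 < c < \sum_(i | P i) lam i ->
  exists2 nu, 0 < nu & \sum_(i | P i) Num.min (lam i) nu = c.
Proof.
move=> /andP[c0 cs]; set s := \sum_(i | P i) lam i in cs *.
have s0 : 0 < s := lt_trans c0 cs.
pose f nu := \sum_(i | P i) Num.min (lam i) nu.
have f0 : f 0 = 0 by rewrite /f big1 // => i /lam0 /ltW /min_idPr.
have fs : f s = s.
  (* By positivity the total [s] dominates each [lam i], so every term is capped at that level. *)
  apply: eq_bigr => i Pi; apply/min_idPl.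
  by rewrite /s (bigD1 i) //= lerDl sumr_ge0 // => j /andP[/lam0/ltW].
have cf : continuous f.
  apply: continuous_big => // [|i _ x]; first exact: add_continuous.
  by apply: continuous_min; [exact: cst_continuous|exact: cvg_id].
have [|||nu nuI fnu] := @IVT R f 0 s c.
- exact: ltW.
- exact: continuous_subspaceT.
- by rewrite f0 fs ge_min le_max (ltW c0) (ltW cs) orbT.
exists nu => //; rewrite lt_neqAle; move: nuI; rewrite in_itv /= => /andP[-> _].
rewrite andbT eq_sym; apply: contraTneq c0 => nu0.
by rewrite -fnu nu0 f0 ltxx.
Qed.

End WaterLevel.

(** * Matrices between 0 and the identity *)

Section UnitBox.
Variables (R : realType) (n : nat).
Implicit Types (M : 'M[R]_n) (lam : 'rV[R]_n).

Lemma psdmx_diag_gt0 M i : psdmx M -> 0 < \det M -> 0 < M i i.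
Proof.
move=> pM M0; rewrite lt_def psdmx_diag_ge0 // andbT.
apply: contraTneq M0 => Mii; rewrite -leNgt.
have /andP[_] := det_psdmx_bounds pM.
by rewrite (bigD1 i) //= Mii mul0r.
Qed.

Lemma subid_psdmx_diag_le1 M i : psdmx (1%:M - M) -> M i i <= 1.
Proof. by move=> /(psdmx_diag_ge0 i); rewrite !mxE eqxx subr_ge0. Qed.

Lemma ln_det_le_diag M : psdmx M -> 0 < \det M ->
  ln (\det M) <= \sum_i ln (M i i).
Proof.
move=> pM M0; have Mi i := psdmx_diag_gt0 i pM M0.
rewrite -ln_prod // ler_ln ?posrE //; last by rewrite prodr_gt0.
by have /andP[] := det_psdmx_bounds pM.
Qed.

(** Weak Lagrangian duality with multiplier [nu^-1]: Hadamard reduces to the diagonal, whose entries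
    lie in (0, 1], and the scalar bound is summed over them. *)
Lemma ln_det_le_water lam nu M :
  0 < nu -> psdmx M -> psdmx (1%:M - M) -> 0 < \det M ->
  ln (\det M) <= \sum_i ln (water nu (lam 0 i)) +
    nu^-1 * (\sum_i lam 0 i * M i i - \sum_i lam 0 i * water nu (lam 0 i)).
Proof.
move=> nu0 pM p1M M0; apply: le_trans (ln_det_le_diag pM M0) _.
rewrite -sumrB mulr_sumr -big_split /=; apply: ler_sum => i _.
by rewrite ln_le_water // psdmx_diag_gt0 //= subid_psdmx_diag_le1.
Qed.

(** Since [M i i <= 1], nonpositive eigenvalues cost at least their full sum. A cost below the total
    forces some positive eigenvalue to exist, and it adds a strictly positive amount because
    [M i i > 0]. *)
Lemma sum_diag_gt_nonpos lam M :
  psdmx M -> psdmx (1%:M - M) -> 0 < \det M ->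
  \sum_i lam 0 i * M i i < \sum_i lam 0 i ->
  \sum_(i | lam 0 i <= 0) lam 0 i < \sum_i lam 0 i * M i i.
Proof.
move=> pM p1M M0 lt_sum.
have le_neg : \sum_(i | lam 0 i <= 0) lam 0 i
    <= \sum_(i | lam 0 i <= 0) lam 0 i * M i i.
  apply: ler_sum => i l0; rewrite -[leLHS]mulr1 ler_wnM2l //.
  exact: subid_psdmx_diag_le1.
rewrite [ltRHS](bigID (fun i => lam 0 i <= 0)) /=.
have [i l0] : exists i, 0 < lam 0 i.
  apply: contrapT => no_i; move: lt_sum; rewrite ltNge => /negP; apply.
  have nonpos i : lam 0 i <= 0.
    by rewrite leNgt; apply/negP => l0; apply: no_i; exists i.
  apply: ler_sum => i _; rewrite -[leLHS]mulr1 ler_wnM2l //.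
  exact: subid_psdmx_diag_le1.
apply: ltr_pwDr => //; rewrite (bigD1 i) /= -?ltNge // ltr_pwDl //.
  by rewrite mulr_gt0 // psdmx_diag_gt0.
apply: sumr_ge0 => j /andP[]; rewrite -ltNge => lj _.
by rewrite mulr_ge0 ?(ltW lj) // psdmx_diag_ge0.
Qed.

End UnitBox.

(** * The whitening change of variables *)

Section Whitening.
Variables (R : realType) (k : nat) (B We SX SV : 'M[R]_k) (De : R).
Variables (T : 'M[R]_k) (lam : 'rV[R]_k).
Hypotheses (uT : T \in unitmx) (TT : T *m T^T = SX).
Hypothesis TW : T^T *m weight_tilde B We *m T = diag_mx lam.

(** Makes the substitution surjective: every [K] is reached from some [M]. *)
Lemma whitenK K : T *m (invmx T *m K *m (invmx T)^T) *m T^T = K.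
Proof.
rewrite trmx_inv !mulmxA mulmxV // mul1mx -mulmxA mulVmx ?mulmx1 //.
by rewrite unitmx_tr.
Qed.

Lemma det_whiten_gt0 : 0 < \det SX.
Proof.
by rewrite -TT det_mulmx det_tr -expr2 exprn_even_gt0 //= -unitfE -unitmxE.
Qed.

Lemma mxtrace_whiten M :
  \tr (weight_tilde B We *m (T *m M *m T^T)) = \sum_i lam 0 i * M i i.
Proof.
rewrite !mulmxA mxtrace_mulC !mulmxA TW mul_diag_mx.
by apply: eq_bigr => i _; rewrite mxE.
Qed.

Lemma feasible_whiten M :
  feasible B We SX SV De (T *m M *m T^T) <->
  [/\ psdmx M, psdmx (1%:M - M) &
      \sum_i lam 0 i * M i i <= distortion_budget B We SX SV De].
Proof.
rewrite /feasible /loewner_le subr0 mxtrace_whiten.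
have -> : SX - T *m M *m T^T = T *m (1%:M - M) *m T^T.
  by rewrite mulmxBr mulmxBl mulmx1 TT.
have pE := psdmx_congr_unit M uT; have p1E := psdmx_congr_unit (1%:M - M) uT.
by split=> -[p1 p2 p3]; (split; [exact/pE | exact/p1E | exact: p3]).
Qed.

Lemma rate_objective_whiten M :
  rate_objective SX (T *m M *m T^T) =
  (if 0 < \det M then (- (2^-1 * ln (\det M)))%:E else +oo%E).
Proof.
have SX0 := det_whiten_gt0.
rewrite /rate_objective.
have -> : \det (T *m M *m T^T) = \det SX * \det M.
  by rewrite -TT !det_mulmx mulrAC.
rewrite pmulr_rgt0 //; case: ifP => // M0.
by rewrite invfM mulrA mulfV ?gt_eqF // mul1r lnV ?posrE // mulrN.
Qed.

End Whitening.

(** * The water-filling optimizer and its properties *)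

Theorem corollary1 (R : realType) (k : nat)
    (B We SX SV : 'M[R]_k) (De : R)
    (hSX : pdmx SX) (hWe : pdmx We) (hSV : psdmx SV)
    (S : 'M[R]_k) (hS : is_pd_sqrtmx SX S)
    (U : 'M[R]_k) (lam : 'rV[R]_k) (hU : orthogonalmx U)
    (hspec : S *m weight_tilde B We *m S = U *m diag_mx lam *m U^T)
    (hfin : (rate_distortion B We SX SV De < +oo)%E) :
  let Wt := weight_tilde B We in
  let AX := S *m Wt *m S in
  let D' := distortion_budget B We SX SV De in
  let rate := rate_distortion B We SX SV De in
  let Ip := pos_indices lam in
  let I0 := nonpos_indices lam in
  exists (d : 'rV[R]_k) (nu : R),
    let Kstar := S *m U *m diag_mx d *m U^T *m S in
    optimizer B We SX SV De Kstar
    /\ (forall i, 0 < d 0 i <= 1)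
    /\ (forall i, i \in I0 -> d 0 i = 1)
    /\ (forall i, i \in Ip -> d 0 i = Num.min 1 (nu / lam 0 i))
    /\ (\tr AX <= D' ->
          Kstar = SX /\ feasible B We SX SV De SX /\ rate = 0%E)
    /\ (D' < \tr AX ->
          (forall K, optimizer B We SX SV De K -> \tr (Wt *m K) = D')
          /\ 0 < nu
          /\ \sum_(i in Ip) Num.min (lam 0 i) nu
               = D' - \sum_(i in I0) lam 0 i
          /\ (forall nu', 0 < nu' ->
                \sum_(i in Ip) Num.min (lam 0 i) nu'
                  = D' - \sum_(i in I0) lam 0 i ->
                nu' = nu))
    /\ ((forall i, i \in Ip -> d 0 i != 1) <->
        (nu%:E < \big[Order.min/+oo]_(i in Ip) (lam 0 i)%:E)%E)
    /\ ((forall i, i \in Ip -> d 0 i != 1) ->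
          ((0 < #|Ip|)%N ->
             nu = (D' - \sum_(i in I0) lam 0 i) / #|Ip|%:R)
          /\ rate = (2^-1 * \sum_(i in Ip) ln (lam 0 i / nu))%:E).
Proof.
move=> Wt AX D' rate Ip I0.
have [pS SS] := hS; have uS := pdmx_unitmx pS.
have sS : S^T = S by case: pS => /symmetricmxP.
have UU : U *m U^T = 1%:M by exact: mulmx1C.
have [_ uU] := mulmx1_unit hU.
pose T := S *m U.
have uT : T \in unitmx by rewrite unitmx_mul uS uU.
have TT : T *m T^T = SX.
  by rewrite trmx_mul sS mulmxA -[S *m U *m U^T]mulmxA UU mulmx1.
have TW : T^T *m Wt *m T = diag_mx lam.
  rewrite trmx_mul sS; transitivity (U^T *m (S *m Wt *m S) *m U).
    by rewrite !mulmxA.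
  by rewrite hspec !mulmxA hU mul1mx -mulmxA hU mulmx1.
have trAX : \tr AX = \sum_i lam 0 i.
  by rewrite /AX hspec mxtrace_mulC mulmxA hU mul1mx mxtrace_diag.
have feasE := feasible_whiten SV De uT TT TW.
have objE := rate_objective_whiten uT TT.
have splitI (F : 'I_k -> R) :
    \sum_i F i = \sum_(i in Ip) F i + \sum_(i in I0) F i.
  rewrite (bigID (fun i => 0 < lam 0 i)) /=; congr (_ + _).
    by apply: eq_bigl => i; rewrite inE.
  by apply: eq_bigl => i; rewrite inE leNgt.
(* A finite infimum yields a feasible point with objective below [+oo], hence with positive
   determinant. *)
have [M0 [pM0 p1M0 cM0] M0_gt0] : exists2 M : 'M[R]_k,
    [/\ psdmx M, psdmx (1%:M - M) & \sum_i lam 0 i * M i i <= D'] & 0 < \det M.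
  have [_ [K fK <-]] := ereal_inf_lt hfin.
  move: fK; rewrite -(whitenK uT K); set M := _ *m K *m _ => /feasE fM.
  by rewrite objE; case: ifP => // M_gt0 _; exists M.
have Ip0 i : i \in Ip -> 0 < lam 0 i by rewrite inE.
(* One [nu] is specified for both regimes, so that [d] gets a single definition. *)
have [nu [nu_gt0 nu_full nu_active]] : exists nu : R,
    [/\ forall i, 0 < lam 0 i -> 0 < nu,
        \sum_i lam 0 i <= D' -> forall i, 0 < lam 0 i -> lam 0 i <= nu
      & D' < \sum_i lam 0 i -> 0 < nu /\
          \sum_(i in Ip) Num.min (lam 0 i) nu = D' - \sum_(i in I0) lam 0 i].
  have [leD|ltD] := leP (\sum_i lam 0 i) D'.
    have le_nu i : 0 < lam 0 i -> lam 0 i <= \sum_(i in Ip) lam 0 i.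
      move=> l0; rewrite (bigD1 i) ?inE //= lerDl.
      by apply: sumr_ge0 => j /andP[/Ip0/ltW].
    (* Under a slack budget any level at or above all positive eigenvalues saturates them; their sum
       is one. *)
    exists (\sum_(i in Ip) lam 0 i); split=> // i l0.
    exact: lt_le_trans l0 (le_nu _ l0).
  have [|nu nu0 nuE] := @water_level_exists R _ (mem Ip) (lam 0) Ip0
      (D' - \sum_(i in I0) lam 0 i).
    (* The nonsingular [M0] fits the budget, yet its cost already exceeds the sum over [I0]. *)
    rewrite ltrBlDr -splitI ltD andbT subr_gt0.
    apply: (lt_le_trans _ cM0).
    have := sum_diag_gt_nonpos pM0 p1M0 M0_gt0 (le_lt_trans cM0 ltD).
    apply: le_lt_trans; rewrite le_eqVlt; apply/orP; left.
    by apply/eqP/eq_bigl => i; rewrite inE.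
  by exists nu; split=> // leD; move: ltD; rewrite ltNge leD.
pose d : 'rV[R]_k := \row_i water nu (lam 0 i).
have dE i : d 0 i = water nu (lam 0 i) by rewrite mxE.
have d_gt0 i : 0 < d 0 i by rewrite dE water_gt0 //; exact: nu_gt0.
have d_le1 i : d 0 i <= 1 by rewrite dE water_le1.
have sum_d : \sum_i lam 0 i * d 0 i =
    \sum_(i in Ip) Num.min (lam 0 i) nu + \sum_(i in I0) lam 0 i.
  rewrite splitI; congr (_ + _); apply: eq_bigr => i; rewrite inE dE mulr_water.
    by move=> ->.
  by rewrite leNgt => /negbTE ->.
have d_full : \sum_i lam 0 i <= D' -> forall i, d 0 i = 1.
  by move=> leD i; rewrite dE water_eq1 //; exact: nu_full.
have sum_d_active : D' < \sum_i lam 0 i -> \sum_i lam 0 i * d 0 i = D'.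
  by move=> /nu_active[_ nuE]; rewrite sum_d nuE subrK.
have det_d : \det (diag_mx d) = \prod_i d 0 i by rewrite det_diag.
have det_d_gt0 : 0 < \det (diag_mx d) by rewrite det_d prodr_gt0.
have ln_det_d : ln (\det (diag_mx d)) = \sum_i ln (d 0 i).
  by rewrite det_d ln_prod.
have KE : S *m U *m diag_mx d *m U^T *m S = T *m diag_mx d *m T^T.
  by rewrite /T trmx_mul sS !mulmxA.
have sum_diag (F : 'I_k -> R) : \sum_i F i * diag_mx d i i = \sum_i F i * d 0 i.
  by apply: eq_bigr => i _; rewrite mxE eqxx mulr1n.
have feas_d : feasible B We SX SV De (T *m diag_mx d *m T^T).
  apply/feasE; split.
  - by apply: psdmx_diag => i; exact: ltW.
  - have -> : 1%:M - diag_mx d = diag_mx (\row_i (1 - d 0 i)).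
      apply/matrixP => i j; rewrite !mxE.
      by case: eqVneq => // _; rewrite subrr.
    by apply: psdmx_diag => i; rewrite mxE subr_ge0.
  - rewrite sum_diag; have [leD|/sum_d_active ->//] := leP (\sum_i lam 0 i) D'.
    by rewrite (eq_bigr (lam 0)) // => i _; rewrite d_full // mulr1.
have ln_det_le M : psdmx M -> psdmx (1%:M - M) -> 0 < \det M ->
    \sum_i lam 0 i * M i i <= D' -> ln (\det M) <= \sum_i ln (d 0 i).
  (* With a slack budget, [M i i <= 1] and [ln 1 = 0] suffice. Otherwise the multiplier term of the
     duality bound is nonpositive, because [d] spends all of [D']. *)
  move=> pM p1M M_gt0 cM; have [leD|ltD] := leP (\sum_i lam 0 i) D'.
    apply: le_trans (ln_det_le_diag pM M_gt0) _; apply: ler_sum => i _.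
    rewrite d_full // ln1; apply: ln_le0; exact: subid_psdmx_diag_le1.
  have [nu0 _] := nu_active ltD.
  apply: le_trans (ln_det_le_water lam nu0 pM p1M M_gt0) _.
  under [X in X + _]eq_bigr do rewrite -dE.
  under [X in _ * (_ - X)]eq_bigr do rewrite -dE.
  by rewrite gerDl pmulr_rle0 ?invr_gt0 // sum_d_active // subr_le0.
have opt_d : optimizer B We SX SV De (T *m diag_mx d *m T^T).
  split=> // K'; rewrite -(whitenK uT K') => /feasE[pM p1M cM].
  rewrite !objE det_d_gt0; case: ifP => [M_gt0|_]; last by rewrite leey.
  rewrite lee_fin lerN2 ler_pM2l ?invr_gt0 // ln_det_d.
  exact: ln_det_le.
have rateE : rate = (- (2^-1 * \sum_i ln (d 0 i)))%:E.
  rewrite -ln_det_d; have := objE (diag_mx d); rewrite det_d_gt0 => <-.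
  apply/eqP; rewrite eq_le; apply/andP; split.
    by apply: ereal_inf_lbound; exists (T *m diag_mx d *m T^T).
  by apply: le_ereal_inf_tmp => _ [K fK <-]; case: opt_d => _; apply.
exists d, nu; rewrite /= KE; split=> //.
split; first by move=> i; rewrite d_gt0 d_le1.
have d_nonpos i : i \in I0 -> d 0 i = 1.
  by rewrite inE dE leNgt /water => /negbTE ->.
split=> //; split; first by move=> i /Ip0 l0; rewrite dE /water l0.
split.
  rewrite trAX => leD.
  have KSX : T *m diag_mx d *m T^T = SX.
    have -> : d = const_mx 1 by apply/rowP => i; rewrite d_full // mxE.
    by rewrite diag_const_mx mulmx1.
  split=> //; split; first by move: feas_d; rewrite KSX.
  rewrite rateE big1 ?mulr0 ?oppr0 //.
  by move=> i _; rewrite d_full // ln1.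
have neq1E i : i \in Ip -> (d 0 i != 1) = (nu < lam 0 i).
  by move=> /Ip0 l0; rewrite dE water_neq1.
split.
  rewrite trAX => ltD; have [nu0 nuE] := nu_active ltD; split; last first.
    split=> //; split=> // nu' nu'0 nu'E.
    apply: (@water_level_uniq R _ (mem Ip) (lam 0) _ _
      (D' - \sum_(i in I0) lam 0 i)) => //.
    by rewrite ltrBlDr -splitI.
  (* Comparison with the finite objective of [d] makes [M] nonsingular. Optimality then forces the
     multiplier term to be nonnegative, so the cost of [M] is at least [D']. *)
  move=> K; rewrite -(whitenK uT K); set M := _ *m K *m _.
  move=> [fK optK]; have /feasE[pM p1M cM] := fK.
  have := optK _ feas_d; rewrite !objE det_d_gt0; case: ifP => // M_gt0.
  rewrite lee_fin lerN2 ler_pM2l ?invr_gt0 // ln_det_d => le_d.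
  have := le_trans le_d (ln_det_le_water lam nu0 pM p1M M_gt0).
  under [X in X + _]eq_bigr do rewrite -dE.
  under [X in _ * (_ - X)]eq_bigr do rewrite -dE.
  rewrite lerDl pmulr_rge0 ?invr_gt0 // sum_d_active // subr_ge0 => geD.
  by rewrite (mxtrace_whiten TW); apply/eqP; rewrite eq_le cM.
split.
  (* The default [+oo] exceeds every real [nu], so for empty [Ip] both sides hold. *)
  split=> [neq1|/bigmin_gtP[_ lt_nu] i iIp].
    apply/bigmin_gtP; split=> [|i iIp]; first exact: ltry.
    by rewrite lte_fin -neq1E //; exact: neq1.
  by rewrite neq1E // -lte_fin; exact: lt_nu.
move=> neq1; split=> [Ip_gt0|].
  have [i iIp] := card_gt0P Ip_gt0.
  (* One unsaturated index excludes the slack regime, where every [d 0 i] is 1. *)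
  have ltD : D' < \sum_i lam 0 i.
    rewrite ltNge; apply/negP => /d_full di.
    by have := neq1 i iIp; rewrite di eqxx.
  have [_ <-] := nu_active ltD.
  rewrite (eq_bigr (fun=> nu)) => [|j jIp].
    by rewrite sumr_const -[nu *+ _]mulr_natr mulfK // pnatr_eq0 -lt0n.
  by apply/min_idPr/ltW; rewrite -neq1E // neq1.
(* Indices in [I0] contribute [ln 1], so an empty [Ip] is covered too, with rate 0. *)
rewrite rateE -mulrN splitI [X in _ + X]big1 ?addr0; last first.
  by move=> i /d_nonpos ->; exact: ln1.
rewrite -sumrN; congr (_ * _)%:E; apply: eq_bigr => i iIp.
have l0 := Ip0 _ iIp; have nul : nu < lam 0 i by rewrite -neq1E // neq1.
have nu0 : 0 < nu := nu_gt0 _ l0.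
have -> : d 0 i = (lam 0 i / nu)^-1.
  rewrite dE /water l0 invf_div; apply/min_idPr.
  by rewrite ler_pdivrMr // mul1r ltW.
by rewrite lnV ?opprK // posrE divr_gt0.
Qed.
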